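(* Let $p>0$ and $m\in(0,p)$. The zero-mass probability $P_r(0;p,m)$ in the LM class is increasing in $r\ge 0$: for every integer $r\ge 0$, $P_r(0;p,m)<P_{r+1}(0;p,m)$.
   Context: For $p>0$ and an integer $r\ge 0$, the LM class natural exponential family (NEF) is the NEF on $\{0,1,2,\dots\}$ with variance function $V_p(m)=\frac{m}{\left(1-\frac mp\right)^r}$ on the mean domain $(0,p)$. (The variance function of an NEF gives the variance of each member as a function of its mean $m$; together with its domain it determines the NEF uniquely. For $r=0$ the variance function is the Poisson one, considered here for means $m\in(0,p)$.) In its mean value parameterization, the member with mean $m$ has probability masses $(\mu_p^* )_n\exp\big(n\psi_p(m)-\phi_{p,r}(m)\big)$, $n=0,1,\dots$, where $\psi_p$ is a primitive of $1/V_p(m)$, $\phi_{p,r}$ is the primitive of $m/V_p(m)$ on $(0,p)$ with $\lim_{m\to0^+}\phi_{p,r}(m)=0$, and $\mu_p^*$ is a generating measure of the NEF with $(\mu_p^* )_0=1$. $P_r(0;p,m)$ denotes the mass at $0$ of the member with mean $m$, that is, $P_r(0;p,m)=\exp(-\phi_{p,r}(m))$. *)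

(* Defs.v *)
From Stdlib Require Import Reals.
From Coquelicot Require Import Coquelicot.
Open Scope R_scope.

(** Stdlib reals with Coquelicot. A measure on {0,1,2,...} is given by its
    masses [mu : nat -> R]. *)

Definition pmf_mean (P : nat -> R) : R :=
  Series (fun n => INR n * P n).

Definition pmf_variance (P : nat -> R) : R :=
  Series (fun n => (INR n - pmf_mean P) ^ 2 * P n).

Definition laplace_term (mu : nat -> R) (theta : R) (n : nat) : R :=
  mu n * exp (INR n * theta).

(** The canonical parameter space: the interior of the convergence set of the
    Laplace transform. All moments of the members exist there, so the totalized
    [Series] above are genuine sums. *)
Definition nef_param (mu : nat -> R) (theta : R) : Prop :=
  locally theta (fun t => ex_series (laplace_term mu t)).

Definition nef_mass (mu : nat -> R) (theta : R) (n : nat) : R :=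
  laplace_term mu theta n / Series (laplace_term mu theta).

(** The measures generating an NEF on {0,1,2,...}: not concentrated at one
    point, nonempty parameter space. Normalizing the mass at 0 to 1 does not
    change the family generated. *)
Definition generating_measure (mu : nat -> R) : Prop :=
  (forall n, 0 <= mu n) /\ mu 0%nat = 1 /\
  (exists n, (0 < n)%nat /\ 0 < mu n) /\
  (exists theta, nef_param mu theta).

Definition nef_mean_domain (mu : nat -> R) (x : R) : Prop :=
  exists theta, nef_param mu theta /\ pmf_mean (nef_mass mu theta) = x.

Definition LM_variance (p : R) (r : nat) (m : R) : R :=
  m / (1 - m / p) ^ r.

(** [mu] generates the NEF with variance function [LM_variance p r] on (0,p).
    For r = 0 this is the Poisson family, whose mean domain is larger than
    (0,p); so the mean domain is asked to be exactly (0,p) only for r > 0. *)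
Definition LM_generating (p : R) (r : nat) (mu : nat -> R) : Prop :=
  generating_measure mu /\
  (forall x, 0 < x < p -> nef_mean_domain mu x) /\
  ((0 < r)%nat -> forall x, nef_mean_domain mu x -> 0 < x < p) /\
  (forall theta, nef_param mu theta ->
     0 < pmf_mean (nef_mass mu theta) < p ->
     pmf_variance (nef_mass mu theta) =
     LM_variance p r (pmf_mean (nef_mass mu theta))).

(** [P] is the mass function of the member with mean [m]. It is unique, since
    the variance function determines the NEF. *)
Definition LM_member (p : R) (r : nat) (m : R) (P : nat -> R) : Prop :=
  exists mu theta, LM_generating p r mu /\ nef_param mu theta /\
    P = nef_mass mu theta /\ pmf_mean P = m.

(* Main.v *)
Require Import Defs.
From Stdlib Require Import Reals.
From Coquelicot Require Import Coquelicot.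
From Stdlib Require Import Lra Lia.
Open Scope R_scope.

(** Let [L t] be the Laplace transform of a generating measure, so that the
    member of parameter [t] has mass [1 / L t] at 0, mean [M t = (ln L)' t] and
    variance [M' t]. Let [G_r x] be the integral of [(1 - y / p) ^ r] over
    [[0, x]]. The variance function gives [M' = M / (1 - M / p) ^ r], hence
    [(ln L - G_r o M)' = 0] on the half-line below the parameter of the member
    of mean [m], where [M] increases and so stays in [(0, m]]. At minus infinity
    [L] tends to 1 and [M] to 0, so the mass at 0 is [exp (- G_r m)], and [G_r m]
    strictly decreases in [r]. *)

(** * Laplace transforms as power series in [exp t] *)

Definition laplace (a : nat -> R) (t : R) : R := Series (laplace_term a t).

(** If [a] are the coefficients of [f], these are the coefficients of [x * f' x]. With [x = exp t]
    this is differentiation in [t], so iterating it yields the successive derivatives of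
    [laplace a]. *)
Definition index_weighted (a : nat -> R) (n : nat) : R := INR n * a n.

Lemma laplace_term_pow (a : nat -> R) (t : R) (n : nat) :
  laplace_term a t n = a n * exp t ^ n.
Proof.
  unfold laplace_term; f_equal.
  induction n as [|n IH]; [simpl; rewrite Rmult_0_l; apply exp_0|].
  rewrite S_INR, Rmult_plus_distr_r, Rmult_1_l, exp_plus, IH; simpl; ring.
Qed.

Lemma laplace_PSeries (a : nat -> R) (t : R) : laplace a t = PSeries a (exp t).
Proof. apply Series_ext; intros n; apply laplace_term_pow. Qed.

Lemma is_derive_continuous (f : R -> R) (x l : R) :
  is_derive f x l -> continuous f x.
Proof.
  intros H; apply (ex_derive_continuous f x).
  now exists l.
Qed.

Lemma index_weighted_PS (a : nat -> R) (n : nat) :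
  index_weighted a n = PS_incr_1 (PS_derive a) n.
Proof.
  unfold index_weighted; destruct n as [|n]; simpl PS_incr_1; [|reflexivity].
  simpl INR; unfold zero; simpl; ring.
Qed.

Lemma CV_radius_index_weighted (a : nat -> R) :
  CV_radius (index_weighted a) = CV_radius a.
Proof.
  rewrite (CV_radius_ext _ _ (index_weighted_PS a)), CV_radius_incr_1.
  apply CV_radius_derive.
Qed.

Lemma ex_series_laplace_term (a : nat -> R) (t : R) :
  Rbar_lt (exp t) (CV_radius a) -> ex_series (laplace_term a t).
Proof.
  intros H.
  apply ex_series_Rabs.
  apply ex_series_ext with (fun n => Rabs (a n * exp t ^ n)).
  { intros n; now rewrite laplace_term_pow. }
  apply CV_disk_inside; rewrite Rabs_pos_eq; [exact H|].
  apply Rlt_le, exp_pos.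
Qed.

Lemma is_derive_laplace (a : nat -> R) (t : R) :
  Rbar_lt (exp t) (CV_radius a) ->
  is_derive (laplace a) t (laplace (index_weighted a) t).
Proof.
  intros H.
  apply is_derive_ext with (fun t => PSeries a (exp t)).
  { intros s; symmetry; apply laplace_PSeries. }
  rewrite laplace_PSeries, (PSeries_ext _ _ _ (index_weighted_PS a)), PSeries_incr_1.
  apply (is_derive_comp (PSeries a) exp); [|apply is_derive_exp].
  apply is_derive_PSeries; rewrite Rabs_pos_eq; [exact H|].
  apply Rlt_le, exp_pos.
Qed.

Lemma is_lim_laplace_m_infty (a : nat -> R) :
  Rbar_lt 0 (CV_radius a) -> is_lim (laplace a) m_infty (a 0%nat).
Proof.
  intros H.
  apply is_lim_ext with (fun t => PSeries a (exp t)).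
  { intros s; symmetry; apply laplace_PSeries. }
  rewrite <- (PSeries_0 a).
  apply is_lim_comp_continuous; [apply is_lim_exp_m|].
  apply continuity_pt_filterlim, PSeries_continuity; now rewrite Rabs_R0.
Qed.

Lemma Series_ge_term (a : nat -> R) (n : nat) :
  (forall k, 0 <= a k) -> ex_series a -> a n <= Series a.
Proof.
  intros ha H.
  apply Rle_trans with (sum_f_R0 a n).
  - destruct n as [|n]; simpl; [lra|].
    pose proof (cond_pos_sum a n ha); lra.
  - apply sum_incr; [|exact ha].
    apply is_series_Reals, Series_correct, H.
Qed.

Lemma Series_ge0 (a : nat -> R) :
  (forall k, 0 <= a k) -> ex_series a -> 0 <= Series a.
Proof.
  intros ha H; apply Rle_trans with (a 0%nat); [apply ha|].
  now apply Series_ge_term.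
Qed.

Lemma laplace_term_ge0 (a : nat -> R) (t : R) (n : nat) :
  0 <= a n -> 0 <= laplace_term a t n.
Proof. intros ha; apply Rmult_le_pos; [exact ha|apply Rlt_le, exp_pos]. Qed.

(** * The parameter space as an open half-line or the whole line *)

(** Strictness comes from the neighbourhood in [nef_param]: the series still converges slightly to
    the right of [t], so a point beyond [exp t] lies in the closed disk of convergence. *)
Lemma nef_param_CV_radius (mu : nat -> R) (t : R) :
  nef_param mu t -> Rbar_lt (exp t) (CV_radius mu).
Proof.
  intros [eps Heps].
  assert (Hs : ex_series (laplace_term mu (t + eps / 2))).
  { apply Heps; unfold ball; simpl; unfold AbsRing_ball, abs, minus, plus, opp; simpl.
    pose proof (cond_pos eps); rewrite Rabs_pos_eq; lra. }
  apply Rbar_lt_le_trans with (exp (t + eps / 2)).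
  { simpl; apply exp_increasing; pose proof (cond_pos eps); lra. }
  (* Outside the closed disk the terms do not tend to 0, which contradicts convergence at
     [t + eps / 2]. *)
  apply Rbar_not_lt_le; intros Hlt.
  apply (CV_disk_outside mu (exp (t + eps / 2))).
  { rewrite Rabs_pos_eq; [exact Hlt|apply Rlt_le, exp_pos]. }
  apply is_lim_seq_ext with (laplace_term mu (t + eps / 2)).
  { intros n; apply laplace_term_pow. }
  now apply ex_series_lim_0.
Qed.

Lemma CV_radius_nef_param (mu : nat -> R) (t : R) :
  Rbar_lt (exp t) (CV_radius mu) -> nef_param mu t.
Proof.
  intros H.
  assert (Hloc : locally t (fun s => Rbar_lt (exp s) (CV_radius mu))).
  { apply (ex_derive_continuous exp t (ex_intro _ _ (is_derive_exp t))
             (fun z => Rbar_lt z (CV_radius mu))).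
    exact (open_Rbar_lt' (exp t) (CV_radius mu) H). }
  unfold nef_param; revert Hloc; apply filter_imp.
  intros s; apply ex_series_laplace_term.
Qed.

Lemma nef_param_le (mu : nat -> R) (s t : R) :
  s <= t -> nef_param mu t -> nef_param mu s.
Proof.
  intros Hst H; apply CV_radius_nef_param.
  apply Rbar_le_lt_trans with (exp t); [|now apply nef_param_CV_radius].
  simpl; destruct Hst as [Hlt| ->]; [apply Rlt_le, exp_increasing, Hlt|lra].
Qed.

Lemma pmf_mean_nef_mass (mu : nat -> R) (t : R) :
  pmf_mean (nef_mass mu t) = laplace (index_weighted mu) t / laplace mu t.
Proof.
  unfold pmf_mean, Rdiv, laplace; rewrite <- Series_scal_r.
  apply Series_ext; intros n.
  unfold nef_mass, laplace_term, index_weighted, Rdiv; ring.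
Qed.

(** * Mean and variance along the family *)

Section GeneratingMeasure.

Variable mu : nat -> R.
Hypothesis hmu : generating_measure mu.

Let mean (t : R) : R := pmf_mean (nef_mass mu t).

(** The term of index 0 alone is 1. This bound justifies every later division by [laplace mu t] and
    its logarithm. *)
Lemma laplace_ge1 (t : R) : nef_param mu t -> 1 <= laplace mu t.
Proof.
  destruct hmu as [hpos [h0 _]]; intros H.
  replace 1 with (laplace_term mu t 0) by
    (rewrite laplace_term_pow, h0; simpl; ring).
  apply Series_ge_term.
  - intros n; apply laplace_term_ge0, hpos.
  - now apply ex_series_laplace_term, nef_param_CV_radius.
Qed.

Lemma pmf_mean_nef_mass_gt0 (t : R) : nef_param mu t -> 0 < mean t.
Proof.
  intros H; unfold mean; rewrite pmf_mean_nef_mass.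
  pose proof (laplace_ge1 t H) as HL.
  destruct hmu as [hpos [_ [[n [Hn Hmun]] _]]].
  apply Rdiv_lt_0_compat; [|lra].
  apply Rlt_le_trans with (laplace_term (index_weighted mu) t n).
  { apply Rmult_lt_0_compat; [|apply exp_pos].
    apply Rmult_lt_0_compat; [now apply lt_0_INR|exact Hmun]. }
  apply Series_ge_term.
  - intros k; apply laplace_term_ge0, Rmult_le_pos; [apply pos_INR|apply hpos].
  - apply ex_series_laplace_term; rewrite CV_radius_index_weighted.
    now apply nef_param_CV_radius.
Qed.

(** Expanding the square splits the series into three Laplace series, with weights 0, 1 and 2 in the
    index. The form [is_series] gives both the value of the variance and the convergence that its
    nonnegativity requires. *)
Lemma is_series_nef_variance (t : R) : nef_param mu t ->
  is_series (fun n => (INR n - mean t) ^ 2 * nef_mass mu t n)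
    (laplace (index_weighted (index_weighted mu)) t / laplace mu t - mean t ^ 2).
Proof.
  intros H.
  pose proof (laplace_ge1 t H) as HL.
  apply nef_param_CV_radius in H.
  set (A := laplace (index_weighted mu) t).
  set (B := laplace (index_weighted (index_weighted mu)) t).
  assert (H0 : is_series (laplace_term mu t) (laplace mu t)).
  { now apply Series_correct, ex_series_laplace_term. }
  assert (H1 : is_series (laplace_term (index_weighted mu) t) A).
  { apply Series_correct, ex_series_laplace_term.
    now rewrite CV_radius_index_weighted. }
  assert (H2 : is_series (laplace_term (index_weighted (index_weighted mu)) t) B).
  { apply Series_correct, ex_series_laplace_term.
    now rewrite !CV_radius_index_weighted. }
  assert (HM : mean t = A / laplace mu t) by apply pmf_mean_nef_mass.
  pose proof (is_series_plus _ _ _ _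
    (is_series_plus _ _ _ _ (is_series_scal (/ laplace mu t) _ _ H2)
       (is_series_scal (- 2 * mean t / laplace mu t) _ _ H1))
    (is_series_scal (mean t ^ 2 / laplace mu t) _ _ H0)) as HS.
  match type of HS with is_series ?f ?l =>
    replace (B / laplace mu t - mean t ^ 2) with l;
    [apply (is_series_ext f); [|exact HS]|] end.
  - intros n; unfold plus, scal; simpl; unfold mult; simpl.
    unfold nef_mass; fold (laplace mu t).
    unfold laplace_term, index_weighted, Rdiv; ring.
  - unfold plus, scal; simpl; unfold mult; simpl.
    rewrite HM; field; lra.
Qed.

(** The quotient rule applied to [L' / L] gives [L'' / L - (L' / L) ^ 2], which is the second moment
    minus the squared mean. *)
Lemma is_derive_pmf_mean (t : R) : nef_param mu t ->
  is_derive mean t (pmf_variance (nef_mass mu t)).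
Proof.
  intros H.
  pose proof (laplace_ge1 t H) as HL.
  replace (pmf_variance (nef_mass mu t)) with
    ((laplace (index_weighted (index_weighted mu)) t * laplace mu t -
      laplace (index_weighted mu) t * laplace (index_weighted mu) t) /
     laplace mu t ^ 2).
  - apply is_derive_ext with (fun s => laplace (index_weighted mu) s / laplace mu s).
    { intros s; symmetry; apply pmf_mean_nef_mass. }
    apply nef_param_CV_radius in H.
    apply is_derive_div; [apply is_derive_laplace..|lra]; [|exact H].
    now rewrite CV_radius_index_weighted.
  - symmetry; etransitivity.
    { exact (is_series_unique _ _ (is_series_nef_variance t H)). }
    unfold mean; rewrite pmf_mean_nef_mass; field; lra.
Qed.

Lemma pmf_variance_nef_mass_ge0 (t : R) :
  nef_param mu t -> 0 <= pmf_variance (nef_mass mu t).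
Proof.
  intros H; apply Series_ge0.
  - intros n; apply Rmult_le_pos; [apply pow2_ge_0|].
    pose proof (laplace_ge1 t H) as HL; fold (laplace mu t).
    apply Rdiv_le_0_compat; [|unfold laplace in HL; lra].
    apply laplace_term_ge0, hmu.
  - eexists; now apply is_series_nef_variance.
Qed.

Lemma pmf_mean_nef_mass_le (s t : R) :
  s <= t -> nef_param mu t -> mean s <= mean t.
Proof.
  intros Hst H.
  destruct (MVT_gen mean s t (fun u => pmf_variance (nef_mass mu u)))
    as [c [Hc Heq]].
  - intros u; rewrite Rmin_left, Rmax_right by lra; intros Hu.
    apply is_derive_pmf_mean, (nef_param_le _ _ t); [lra|exact H].
  - intros u; rewrite Rmin_left, Rmax_right by lra; intros Hu.
    eapply continuity_pt_filterlim, is_derive_continuous, is_derive_pmf_mean, (nef_param_le _ _ t); [lra|exact H].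
  - rewrite Rmin_left, Rmax_right in Hc by lra.
    assert (Hv : 0 <= pmf_variance (nef_mass mu c)).
    { apply pmf_variance_nef_mass_ge0, (nef_param_le _ _ t); [lra|exact H]. }
    assert (0 <= pmf_variance (nef_mass mu c) * (t - s))
      by (apply Rmult_le_pos; lra).
    lra.
Qed.

(** In [L' / L] the numerator tends to its coefficient of index 0, which is 0, and the denominator
    to [mu 0 = 1]. *)
Lemma is_lim_pmf_mean : is_lim mean m_infty 0.
Proof.
  pose proof hmu as [_ [h0 [_ [t Ht]]]].
  assert (HR : Rbar_lt 0 (CV_radius mu)).
  { apply Rbar_lt_trans with (exp t); [apply exp_pos|].
    now apply nef_param_CV_radius. }
  apply is_lim_ext with (fun s => laplace (index_weighted mu) s / laplace mu s).
  { intros s; symmetry; apply pmf_mean_nef_mass. }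
  replace (Finite 0) with (Rbar_div (index_weighted mu 0) (mu 0%nat)).
  2:{ rewrite h0; unfold index_weighted; simpl; f_equal; field. }
  apply is_lim_div.
  - apply is_lim_laplace_m_infty; now rewrite CV_radius_index_weighted.
  - now apply is_lim_laplace_m_infty.
  - rewrite h0; intros E; injection E; lra.
  - now rewrite h0.
Qed.

End GeneratingMeasure.

(** * The integral [G_r] and its monotonicity in [r] *)

(** Closed form of [G_r], the primitive of [x / LM_variance p r x] on [(0, p)] with limit 0 at 0. *)
Definition LM_phi (p : R) (r : nat) (x : R) : R :=
  p / INR (S r) * (1 - (1 - x / p) ^ S r).

Lemma is_derive_LM_phi (p : R) (r : nat) (x : R) : p <> 0 ->
  is_derive (LM_phi p r) x ((1 - x / p) ^ r).
Proof.
  intros hp.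
  pose proof (not_0_INR (S r) (Nat.neq_succ_0 r)) as Hr.
  unfold LM_phi; auto_derive; [exact I|].
  change (Init.Nat.pred (S r)) with r.
  change (match r with 0%nat => 1 | S _ => INR r + 1 end) with (INR (S r)) in *.
  replace (1 + - (x * / p)) with (1 - x / p) by (unfold Rdiv; ring).
  field; now split.
Qed.

(** The sequence [q ^ k * (1 + k * (1 - q))] starts at 1 and drops by
    [q ^ k * (k + 1) * (1 - q) ^ 2] from [k] to [k + 1]. *)
Lemma mul_pow_lt_one (q : R) (n : nat) : 0 < q < 1 ->
  q ^ S n * (1 + INR (S n) * (1 - q)) < 1.
Proof.
  intros hq.
  assert (step : forall k, q ^ S k * (1 + INR (S k) * (1 - q)) <
                           q ^ k * (1 + INR k * (1 - q))).
  { intros k; rewrite S_INR; simpl.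
    assert (0 < q ^ k * ((INR k + 1) * (1 - q) ^ 2)); [|lra].
    pose proof (pos_INR k).
    repeat apply Rmult_lt_0_compat; try apply pow_lt; lra. }
  induction n as [|n IH].
  - eapply Rlt_le_trans; [apply step|simpl; lra].
  - eapply Rlt_trans; [apply step|exact IH].
Qed.

Lemma LM_phi_decr (p x : R) (r : nat) : 0 < x < p ->
  LM_phi p (S r) x < LM_phi p r x.
Proof.
  intros hx; unfold LM_phi.
  assert (hq : 0 < 1 - x / p < 1).
  { assert (0 < x / p) by (apply Rdiv_lt_0_compat; lra).
    assert (x / p < 1) by (apply Rlt_div_l; lra).
    lra. }
  set (q := 1 - x / p) in *.
  pose proof (mul_pow_lt_one q r hq) as H.
  assert (Hr : 0 < INR (S r)) by (apply lt_0_INR; lia).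
  rewrite (S_INR (S r)).
  apply Rlt_0_minus.
  (* Over a common denominator, the difference of the closed forms has exactly the factor bounded by
     [mul_pow_lt_one]. *)
  replace (p / INR (S r) * (1 - q ^ S r) -
           p / (INR (S r) + 1) * (1 - q ^ S (S r))) with
    (p / (INR (S r) * (INR (S r) + 1)) *
     (1 - q ^ S r * (1 + INR (S r) * (1 - q)))).
  - apply Rmult_lt_0_compat; [|lra].
    apply Rdiv_lt_0_compat; [lra|apply Rmult_lt_0_compat; lra].
  - rewrite <- (tech_pow_Rmult q (S r)); field; lra.
Qed.

(** * The mass at 0 in closed form *)

Lemma ln_laplace_LM (p m : R) (r : nat) (mu : nat -> R) (theta : R) :
  0 < m < p -> LM_generating p r mu -> nef_param mu theta ->
  pmf_mean (nef_mass mu theta) = m ->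
  ln (laplace mu theta) = LM_phi p r m.
Proof.
  intros hm [hmu [_ [_ hvar]]] H hmean.
  set (M := fun t => pmf_mean (nef_mass mu t)).
  set (h := fun t => ln (laplace mu t) - LM_phi p r (M t)).
  assert (Hd : forall t, t <= theta -> is_derive h t 0).
  { intros t Ht.
    assert (Hpar : nef_param mu t) by now apply (nef_param_le _ _ theta).
    pose proof (laplace_ge1 mu hmu t Hpar) as HL.
    (* Staying at or below [m < p] makes [hvar] applicable at [t] and keeps [1 - M t / p]
       positive. *)
    assert (HM : 0 < M t <= m).
    { split; [now apply pmf_mean_nef_mass_gt0|].
      rewrite <- hmean; now apply pmf_mean_nef_mass_le. }
    assert (Hq : 0 < 1 - M t / p).
    { assert (M t / p < 1) by (apply Rlt_div_l; lra). lra. }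
    (* Both chain-rule terms equal [M t]: the first is [L' / L], and in the second the power cancels
       the denominator of [LM_variance]. *)
    replace 0 with
      (minus (scal (laplace (index_weighted mu) t) (/ laplace mu t))
             (scal (pmf_variance (nef_mass mu t)) ((1 - M t / p) ^ r))).
    - apply @is_derive_minus.
      + apply (is_derive_comp ln (laplace mu)); [apply is_derive_ln; lra|].
        now apply is_derive_laplace, nef_param_CV_radius.
      + apply (is_derive_comp (LM_phi p r) M); [apply is_derive_LM_phi; lra|].
        now apply is_derive_pmf_mean.
    - rewrite hvar by (trivial; fold (M t); lra).
      unfold minus, plus, opp, scal; simpl; unfold mult; simpl.
      unfold LM_variance; fold (M t).
      replace (laplace (index_weighted mu) t * / laplace mu t) with (M t)
        by apply pmf_mean_nef_mass.
      pose proof (pow_lt _ r Hq) as Hpow.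
      set (Q := (1 - M t / p) ^ r) in *; field; lra. }
  assert (Hconst : forall t, t <= theta -> h t = h theta).
  { intros t Ht.
    destruct (MVT_gen h t theta (fun _ => 0)) as [c [_ Heq]]; [..|lra].
    - intros u; rewrite Rmin_left, Rmax_right by lra; intros Hu.
      apply Hd; lra.
    - intros u; rewrite Rmin_left, Rmax_right by lra; intros Hu.
      apply continuity_pt_filterlim, (is_derive_continuous h u 0), Hd; lra. }
  assert (Hlim : is_lim h m_infty 0).
  { pose proof hmu as [_ [h0 _]].
    replace (Finite 0) with (Finite (ln 1 - LM_phi p r 0)).
    2:{ rewrite ln_1; unfold LM_phi, Rdiv; f_equal.
        rewrite Rmult_0_l, Rminus_0_r, pow1; ring. }
    apply is_lim_minus'.
    - apply is_lim_comp_continuous.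
      + rewrite <- h0; apply is_lim_laplace_m_infty.
        apply Rbar_lt_trans with (exp theta); [apply exp_pos|].
        now apply nef_param_CV_radius.
      + eapply is_derive_continuous, is_derive_ln; lra.
    - apply is_lim_comp_continuous; [now apply is_lim_pmf_mean|].
      eapply is_derive_continuous, is_derive_LM_phi; lra. }
  (* Being constant to the left of [theta], [h] also has limit [h theta]; uniqueness of the limit
     forces this value to be 0. *)
  assert (Hlim' : is_lim h m_infty (h theta)).
  { apply is_lim_ext_loc with (fun _ => h theta); [|apply is_lim_const].
    exists theta; intros t Ht; symmetry; apply Hconst; lra. }
  assert (E : h theta = 0).
  { apply is_lim_unique in Hlim; apply is_lim_unique in Hlim'.
    congruence. }
  unfold h, M in E; rewrite hmean in E; lra.
Qed.

(** Since [mu 0 = 1], the mass at 0 is [1 / L = exp (- ln L)]. The result involves neither [mu] nor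
    [theta], so members for different [r] can be compared directly. *)
Lemma LM_member_mass0 (p m : R) (r : nat) (P : nat -> R) :
  0 < m < p -> LM_member p r m P -> P 0%nat = exp (- LM_phi p r m).
Proof.
  intros hm [mu [theta [Hgen [Hpar [-> Hmean]]]]].
  rewrite <- (ln_laplace_LM p m r mu theta) by assumption.
  pose proof Hgen as [hmu _].
  pose proof (laplace_ge1 mu hmu theta Hpar) as HL.
  rewrite exp_Ropp, exp_ln by lra.
  unfold nef_mass; fold (laplace mu theta).
  rewrite laplace_term_pow; destruct hmu as [_ [-> _]].
  simpl; unfold Rdiv; ring.
Qed.

Theorem proposition9 (p m : R) (hp : 0 < p) (hm : 0 < m < p) (r : nat)
    (Pr Pr1 : nat -> R)
    (hPr : LM_member p r m Pr) (hPr1 : LM_member p (S r) m Pr1) :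
  Pr 0%nat < Pr1 0%nat.
Proof.
  rewrite (LM_member_mass0 p m r Pr hm hPr).
  rewrite (LM_member_mass0 p m (S r) Pr1 hm hPr1).
  apply exp_increasing, Ropp_lt_contravar, LM_phi_decr, hm.
Qed.
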